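(* Suppose that the sampling time $T>0$ is non-pathological for $A$: with $\lambda_1,\dots,\lambda_n$ the eigenvalues of $A$ and $i$ the imaginary unit, $\lambda_j-\lambda_l\neq \frac{2q\pi}{T}i$ for any distinct $j,l\in\{1,\dots,n\}$ and any positive integer $q$. Let $N=n+m$, and let $(u,x)$ be a trajectory of the system on $[0,NT)$ where $u$ is a piecewise constant input designed by the online experiment design procedure described in the context. Then $$\operatorname{rank}\begin{bmatrix}\chi_{[0,N-1]}(t)\\ \mu_{[0,N-1]}\end{bmatrix}=n+m\qquad\text{for all } t\in[0,T).$$
   Context: Consider the linear system $\dot x(t)=Ax(t)+Bu(t)$, $x(0)=x_0$, with $A\in\mathbb{R}^{n\times n}$, $B\in\mathbb{R}^{n\times m}$, $(A,B)$ controllable. A trajectory on $[0,NT)$ is a pair $(u,x)$ with $u:[0,NT)\to\mathbb{R}^m$ piecewise continuous, $x:[0,NT)\to\mathbb{R}^n$ absolutely continuous, satisfying the system equation for almost all $t\in[0,NT)$. Sampled data: for $t\in[0,T)$, $\chi_k(t)=x(t+kT)$ and $\chi_{[0,N-1]}(t)=[\chi_0(t)\ \cdots\ \chi_{N-1}(t)]\in\mathbb{R}^{n\times N}$; moreover $\chi_k=\chi_k(0)=x(kT)$, $\chi_{[0,k-1]}=[\chi_0\ \cdots\ \chi_{k-1}]$, $\mu_{[0,k-1]}=[\mu_0\ \cdots\ \mu_{k-1}]$. Online experiment design procedure: the input is piecewise constant, $u(t+kT)=\mu_k\in\mathbb{R}^m$ for $t\in[0,T)$, $k=0,\dots,N-1$,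 with $\mu_0\neq0$ and, for each $k\in\{1,\dots,N-1\}$: if $\chi_k\notin\operatorname{im}\chi_{[0,k-1]}$, then $\mu_k$ is arbitrary; if $\chi_k\in\operatorname{im}\chi_{[0,k-1]}$, then one takes $\xi\in\mathbb{R}^n$ and $\eta\in\mathbb{R}^m$ with $\eta\neq0$ and $\begin{bmatrix}\xi^\top&\eta^\top\end{bmatrix}\begin{bmatrix}\chi_{[0,k-1]}\\ \mu_{[0,k-1]}\end{bmatrix}=0$ (such $\xi,\eta$ exist under the stated assumptions on $(A,B)$ and $T$), and $\mu_k$ is chosen such that $\xi^\top\chi_k+\eta^\top\mu_k\neq0$. *)

(* Defs.v *)
(* MathComp-Analysis; [R[i]] is the type of complex numbers of
   mathcomp-real-closed. *)
From mathcomp Require Import all_boot all_order all_algebra.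
From mathcomp Require Import all_classical all_reals all_analysis.
From mathcomp Require Import complex.

Set Implicit Arguments.
Unset Strict Implicit.
Unset Printing Implicit Defensive.

Import Order.TTheory GRing.Theory Num.Theory.
Import numFieldNormedType.Exports.

Local Open Scope classical_set_scope.
Local Open Scope ring_scope.

(* Functions of time are total functions [R -> V]; every notion below only
   constrains their values on the indicated interval, values outside it being
   irrelevant. *)

(* Finitely many breakpoints, with finite one-sided limits everywhere
   (in particular at 0 from the right and at [L] from the left). *)
Definition piecewise_continuous (R : realType) (V : normedModType R) (L : R)
    (u : R -> V) : Prop :=
  [/\ exists s : seq R,
        forall t : R, 0 < t < L -> t \notin s -> {for t, continuous u},
      forall t : R, 0 <= t < L -> cvg (u @ t^'+)
    & forall t : R, 0 < t <= L -> cvg (u @ t^'-)].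

(* A pair [p] in [s] stands for the interval with endpoints [p.1 < p.2]; the
   intervals of the family are non-overlapping. *)
Definition absolutely_continuous (R : realType) (V : normedModType R)
    (I : interval R) (f : R -> V) : Prop :=
  forall e : R, 0 < e -> exists2 d : R, 0 < d &
    forall s : seq (R * R),
      all (fun p => [&& p.1 \in I, p.2 \in I & p.1 < p.2]) s ->
      pairwise (fun p q => (p.2 <= q.1) || (q.2 <= p.1)) s ->
      \sum_(p <- s) (p.2 - p.1) < d ->
      \sum_(p <- s) `|f p.2 - f p.1| < e.

(* [is_derive] is two-sided, so at [t = 0] it also sees [x] on negative times;
   this does not matter, since the equation is only required almost
   everywhere. *)
Definition trajectory (R : realType) (n m : nat) (A : 'M[R]_n)
    (B : 'M[R]_(n, m)) (L : R) (u : R -> 'cV[R]_m) (x : R -> 'cV[R]_n) : Prop :=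
  [/\ piecewise_continuous L u,
      absolutely_continuous `[0, L[ x
    & {ae @lebesgue_measure R, forall t : R,
        0 <= t < L -> is_derive t (1 : R) x (A *m x t + B *m u t)}].

Definition controllable (R : realType) (n m : nat) (A : 'M[R]_n)
    (B : 'M[R]_(n, m)) : Prop :=
  forall x0 x1 : 'cV[R]_n,
    exists (L t1 : R) (u : R -> 'cV[R]_m) (x : R -> 'cV[R]_n),
      [/\ 0 < t1 < L, trajectory A B L u x, x 0 = x0 & x t1 = x1].

(* [real_complex R] is the embedding of [R] into [R[i]].  Equal eigenvalues
   (repeated entries in the list of eigenvalues) impose no constraint, since
   the right-hand side is nonzero. *)
Definition non_pathological (R : realType) (n : nat) (A : 'M[R]_n) (T : R) :
    Prop :=
  forall l1 l2 : R[i],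
    eigenvalue (map_mx (real_complex R) A) l1 ->
    eigenvalue (map_mx (real_complex R) A) l2 ->
    l1 != l2 ->
    forall q : nat, (0 < q)%N ->
      l1 - l2 != (0 +i* (2 * q%:R * pi / T))%C.

(* The matrix [f_0 ... f_{k-1}]. *)
Definition cols (R : realType) (p : nat) (f : nat -> 'cV[R]_p) (k : nat) :
    'M[R]_(p, k) :=
  \matrix_(i < p, j < k) f j i 0.

Definition sample (R : realType) (n : nat) (x : R -> 'cV[R]_n) (T t : R)
    (k : nat) : 'cV[R]_n :=
  x (t + k%:R * T).

Definition online_design (R : realType) (n m N : nat) (chi : nat -> 'cV[R]_n)
    (mu : nat -> 'cV[R]_m) : Prop :=
  mu 0%N != 0 /\
  forall k : nat, (0 < k < N)%N ->
    (exists c : 'cV[R]_k, chi k = cols chi k *m c) ->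
    exists (xi : 'cV[R]_n) (eta : 'cV[R]_m),
      [/\ eta != 0,
          row_mx xi^T eta^T *m col_mx (cols chi k) (cols mu k) = 0
        & xi^T *m chi k + eta^T *m mu k != 0].

(* Main.v *)
Require Import Defs.
From mathcomp Require Import all_boot all_order all_algebra.
From mathcomp Require Import all_classical all_reals all_analysis.
From mathcomp Require Import measurable_realfun complex.
From mathcomp Require Import ring lra.

(** At [t = 0] the matrix of samples and inputs is square of size [n + m], and
    its columns are independent by induction on their number: if the new column
    were a combination of the previous ones, then the sampled state would lie in
    the image of the previous states, so that the design provides a covector
    [xi, eta] that annihilates all the previous columns but not the new one
    ([online_design_free]).

    For another [t] in [0, T[, suppose that coefficients [c_k] combine the
    columns at time [t] to zero. Since the input is constant on each sampling
    period, the superposition [z s = \sum_k c_k x (s + k T)] of the periods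
    solves [z' = A z + B (\sum_k c_k mu_k) = A z] almost everywhere on [0, T[,
    and it vanishes at [t]. A solution of a homogeneous linear equation that
    vanishes once vanishes at all earlier times ([linear_ode_zero]), so
    [z 0 = 0]: the same [c_k] combine the columns at time [0] to zero, hence all
    are zero.

    Uniqueness is needed for absolutely continuous solutions of an equation that
    holds almost everywhere. It rests on a mean value inequality for such
    functions ([abs_cont_mean_value]): split the interval into pieces where the
    derivative controls the increment and pieces inside an open set of small
    measure that covers the exceptional null set; absolute continuity makes the
    increments over the latter negligible. *)

Set Implicit Arguments.
Unset Strict Implicit.
Unset Printing Implicit Defensive.

Import Order.TTheory GRing.Theory Num.Theory numFieldNormedType.Exports.

Local Open Scope ring_scope.

(** * Tools on the real line *)

(** Compactness of a segment as an induction principle: a property that crosses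
    a neighborhood of each point propagates from one end to the other, because
    the supremum of the points that it reaches can only be [b]. The step goes
    from the left to the right of [t] at once, so that no separate closure
    condition is needed at that supremum. *)
Lemma segment_step_ind {R : realType} (a b : R) (Q : R -> Prop) :
  a <= b -> Q a ->
  (forall t, a <= t <= b -> exists2 eta : R, 0 < eta &
     forall s s', a <= s -> s <= t -> t <= s' -> s' <= b ->
       t - eta < s -> s' < t + eta -> Q s -> Q s') ->
  Q b.
Proof.
move=> ab Qa step.
pose S := [set s | a <= s <= b /\ Q s]%classic.
have S_a : S a by split=> //; rewrite lexx ab.
have ubS : ubound S b by move=> s [/andP[]].
have supS : has_sup S by split; [exists a|exists b].
have a_sup : a <= sup S by apply: ub_le_sup => //; exists b.
have sup_b : sup S <= b by apply: ge_sup => //; exists a.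
have [|eta eta0 stepc] := step (sup S); first by rewrite a_sup.
have [s [/andP[s_a s_b] Qs] s_lt] := sup_adherent eta0 supS.
have s_sup : s <= sup S by apply: ub_le_sup; [exists b|split=> //; rewrite s_a].
have [sup_lt|] := ltP (sup S + eta / 2) b; last first.
  by move=> ?; apply: (stepc s b) => //; lra.
have Qs' : Q (sup S + eta / 2) by apply: (stepc s) => //; lra.
have : sup S + eta / 2 <= sup S.
  by apply: ub_le_sup; [exists b|split=> //; apply/andP; split; lra].
lra.
Qed.

(** Lebesgue measure is translation invariant: its image under a translation
    agrees with it on the intervals that determine it. *)
Lemma ae_shift {R : realType} (P : R -> Prop) (c : R) :
  {ae @lebesgue_measure R, forall t : R, P t} ->
  {ae @lebesgue_measure R, forall t : R, P (t + c)}.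
Proof.
case=> N [mN N0 PN].
have mshift : measurable_fun setT (shift c : R -> R).
  by apply: measurable_funD => //; exact: measurable_cst.
exists ((shift c : R -> R) @^-1` N)%classic; split.
- by rewrite -[X in measurable X]setTI; exact: mshift.
- rewrite -N0; apply/esym.
  apply: (@lebesgue_measure_unique R (pushforward (@lebesgue_measure R)
    (shift c : R -> measurableTypeR R))) => //.
  move=> _ [[p q]] _ <-.
  transitivity (@lebesgue_measure R `]p - c, q - c]%classic).
    rewrite !lebesgue_measure_itv/= !lte_fin ltrD2r.
    by case: ifP => // _; congr (_%:E); ring.
  rewrite /pushforward; congr (lebesgue_measure _).
  by apply/seteqP; split=> y /=; rewrite !in_itv/= ltrBlDr lerBrDr.
- by move=> t /= nPt; apply: PN.
Qed.

(** This holds on both sides of [t], as [segment_step_ind] asks for. *)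
Lemma is_derive_local_bound {R : realType} {V : normedModType R} (z : R -> V)
    (t M e : R) (v : V) :
  0 < e -> is_derive t 1 z v -> `|v| <= M ->
  exists2 eta : R, 0 < eta &
    forall s, `|s - t| < eta -> `|z s - z t| <= (M + e) * `|s - t|.
Proof.
move=> e0 dz vM.
have := @ex_derive _ _ _ _ _ _ _ dz; rewrite /derivable => cz.
have zv : (h^-1 *: ((z \o shift t) (h *: 1) - z t) @[h --> 0^'] --> v)%classic.
  by rewrite -(@derive_val _ _ _ _ _ _ _ dz).
move/cvgrPdist_lt : zv => /(_ e e0).
move=> /nbhs_ballP[eta /= eta0 etaP]; exists eta => // s s_eta.
have [->|st] := eqVneq s t; first by rewrite !subrr !normr0 mulr0.
have h0 : s - t != 0 by rewrite subr_eq0.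
have /= := etaP (s - t); rewrite /ball/= sub0r normrN => /(_ s_eta h0).
have -> : (s - t) *: (1 : R^o) + t = s by rewrite /GRing.scale/= mulr1 subrK.
set q := _^-1 *: _ => vq.
have -> : z s - z t = (s - t) *: q by rewrite /q scalerA divff// scale1r.
rewrite normrZ mulrC ler_wpM2r//.
rewrite -(subKr v q) (le_trans (ler_normB _ _))// lerD// ltW//.
Qed.

Lemma is_derive_comp_shift {R : realType} {V : normedModType R} (f : R -> V)
    (c t : R) (v : V) :
  is_derive (t + c) 1 f v -> is_derive t 1 (f \o shift c) v.
Proof.
move=> df; have E : ((f \o shift c) \o shift t = f \o shift (t + c)).
  by apply/funext => h /=; rewrite addrA.
apply: DeriveDef.
  by rewrite /derivable E; exact: (@ex_derive _ _ _ _ _ _ _ df).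
by rewrite /derive E; exact: (@derive_val _ _ _ _ _ _ _ df).
Qed.

(** * Absolutely continuous functions *)

Lemma abs_cont_subset {R : realType} {V : normedModType R} (I J : interval R)
    (f : R -> V) :
  {subset I <= J} -> absolutely_continuous J f -> absolutely_continuous I f.
Proof.
move=> IJ acf e /acf[d d0 fd]; exists d => // s sI; apply: fd.
by apply: sub_all sI => p /and3P[p1 p2 ->]; rewrite !IJ.
Qed.

Lemma abs_contD {R : realType} {V : normedModType R} (I : interval R)
    (f g : R -> V) : absolutely_continuous I f -> absolutely_continuous I g ->
  absolutely_continuous I (f \+ g).
Proof.
move=> acf acg e e0; have e2 : 0 < e / 2 by rewrite divr_gt0.
have [d d0 fd] := acf _ e2; have [d' d'0 gd] := acg _ e2.
exists (Num.min d d'); first by rewrite lt_min d0.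
move=> s sI sdisj; rewrite lt_min => /andP[sd sd'].
have := ltrD (fd _ sI sdisj sd) (gd _ sI sdisj sd').
rewrite -splitr; apply: le_lt_trans; rewrite -big_split/=.
by apply: ler_sum => p _; rewrite opprD addrACA ler_normD.
Qed.

Lemma abs_contZ {R : realType} {V : normedModType R} (I : interval R) (c : R)
    (f : R -> V) :
  absolutely_continuous I f -> absolutely_continuous I (c \*: f).
Proof.
move=> acf e e0; have c1 : 0 < `|c| + 1 by rewrite ltr_wpDl.
have [|d d0 fd] := acf (e / (`|c| + 1)); first by rewrite divr_gt0.
exists d => // s sI sdisj sd; have := fd _ sI sdisj sd.
rewrite ltr_pdivlMr//; apply: le_lt_trans.
rewrite mulr_suml; apply: ler_sum => p _.
by rewrite -scalerBr normrZ mulrC ler_wpM2l// lerDl.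
Qed.

Lemma abs_cont_sum {R : realType} {V : normedModType R} (I : interval R)
    (N : nat) (f : 'I_N -> R -> V) : (forall k, absolutely_continuous I (f k)) ->
  absolutely_continuous I (\sum_(k < N) f k).
Proof.
move=> acf; apply: (big_ind (absolutely_continuous I)) => //.
- move=> e e0; exists 1 => // s _ _ _; rewrite big1// => p _.
  by rewrite subrr normr0.
- by move=> g h; exact: abs_contD.
Qed.

Lemma abs_cont_shift {R : realType} {V : normedModType R} (I J : interval R)
    (c : R) (f : R -> V) : (forall t, t \in I -> t + c \in J) ->
  absolutely_continuous J f -> absolutely_continuous I (f \o shift c).
Proof.
move=> IJ acf e /acf[d d0 fd]; exists d => // s sI sdisj sd.
have := fd [seq (p.1 + c, p.2 + c) | p <- s]; rewrite all_map !big_map/=; apply.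
- by apply: sub_all sI => p /and3P[p1 p2 p12] /=; rewrite !IJ// ltrD2r.
- rewrite pairwise_map; apply: sub_pairwise sdisj => p q /=.
  by rewrite !lerD2r.
- by under eq_bigr do rewrite opprD addrACA subrr addr0.
Qed.

Lemma abs_cont_uniform {R : realType} {V : normedModType R} (I : interval R)
    (f : R -> V) : absolutely_continuous I f ->
  forall e, 0 < e -> exists2 d, 0 < d &
    forall s t, s \in I -> t \in I -> `|s - t| < d -> `|f s - f t| < e.
Proof.
move=> acf e e0; have [d d0 fd] := acf e e0; exists d => // s t sI tI.
wlog st : s t sI tI / s < t => [wlg|].
  have [->|nst] := eqVneq s t; first by rewrite !subrr !normr0.
  have [st|ts|/eqP] := ltgtP s t; [exact: wlg| |by rewrite (negbTE nst)].
  by rewrite (distrC s) (distrC (f s)); exact: (wlg t s).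
rewrite (distrC s) (distrC (f s)) gtr0_norm ?subr_gt0// => std.
by have := fd [:: (s, t)]; rewrite !big_seq1/= sI tI st; apply.
Qed.

(** For fixed [e], the points reached by [segment_step_ind] are those [s] such
    that the increment of [z] on [a, s] is at most [(M + e) * (s - a)] plus the
    variation over a finite family of disjoint intervals that lie in a small
    open set [U] containing the exceptional points. Next to a point of [U] the
    family is extended by one interval; next to any other point the derivative
    bounds the increment. The total length of the family stays below the measure
    of [U], so absolute continuity bounds its variation by [e]. *)
Lemma abs_cont_mean_value {R : realType} {V : normedModType R} (z : R -> V)
    (a b M : R) :
  a <= b -> 0 <= M -> absolutely_continuous `[a, b] z ->
  {ae @lebesgue_measure R, forall t, a <= t <= b ->
     exists2 v, is_derive t 1 z v & `|v| <= M} ->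
  `|z b - z a| <= M * (b - a).
Proof.
move=> ab M0 acz dz.
suff main e : 0 < e -> `|z b - z a| <= (M + e) * (b - a) + e.
  apply/ler_addgt0Pr => e e0.
  have ba1 : 0 < b - a + 1 by lra.
  (* This value makes the two error terms add up to the given one. *)
  apply: (le_trans (main (e / (b - a + 1)) _)); first by rewrite divr_gt0.
  by rewrite le_eqVlt; apply/orP; left; apply/eqP; field; rewrite gt_eqF.
move=> e0; have [d d0 zd] := acz e e0.
have [U [oU NU Ud]] : exists U : set R,
    [/\ open U, (~` [set t | a <= t <= b ->
      exists2 v, is_derive t 1 z v & `|v| <= M] `<=` U)%classic &
      (lebesgue_measure U < d%:E)%E].
  have [|U [oU NU Ud]] := outer_measure_open_le
    (~` [set t | a <= t <= b ->
      exists2 v, is_derive t 1 z v & `|v| <= M])%classic (e := d / 2).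
    by rewrite divr_gt0.
  exists U; split=> //; apply: (le_lt_trans Ud).
  rewrite (negligible_outer_measure _).1// add0e lte_fin.
  by rewrite gtr_pMr// invf_lt1// ltr1n.
have mU : measurable (U : set (measurableTypeR R)) by exact: open_measurable.
(* Cutting [U] at [s] makes the bound on the total length additive when an
   interval starting at [s] is added to the family. *)
pose inU s := (U `&` `[a, s[)%classic : set (measurableTypeR R).
have minU s : measurable (inU s) by apply: measurableI.
pose len (l : seq (R * R)) := \sum_(p <- l) (p.2 - p.1).
pose var (l : seq (R * R)) := \sum_(p <- l) `|z p.2 - z p.1|.
pose Q s := exists l : seq (R * R),
  [/\ all (fun p => [&& p.1 \in `[a, b], p.2 \in `[a, b] & p.1 < p.2]) l &
      all (fun p => p.2 <= s) l] /\
  [/\ pairwise (fun p q => (p.2 <= q.1) || (q.2 <= p.1)) l,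
      ((len l)%:E <= lebesgue_measure (inU s))%E &
      `|z s - z a| <= (M + e) * (s - a) + var l].
suff [l [[lab _] [ldisj lU lz]]] : Q b.
  apply: (le_trans lz); rewrite lerD2l ltW// zd// -lte_fin.
  apply: (le_lt_trans lU); apply: le_lt_trans Ud.
  by apply: le_measure; rewrite ?inE; [exact: minU| |move=> y []].
apply: (segment_step_ind (Q := Q) ab).
  exists [::]; split; split=> //.
    by rewrite /len big_nil measure_ge0.
  by rewrite /var big_nil !subrr normr0 mulr0 addr0.
move=> t tab; have [tU|tU] := pselect (U t).
  have /nbhs_ballP[eta /= eta0 etaU] := open_nbhs_nbhs (conj oU tU).
  exists eta => // s s' a_s s_t t_s' s'_b s_eta s'_eta.
  move=> [l [[lab ls] [ldisj lU lz]]].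
  have := le_trans s_t t_s'; rewrite le_eqVlt => /predU1P[<-|ss'].
    by exists l.
  exists ((s, s') :: l); split; split=> /=.
  - by rewrite !in_itv/= lab ss' andbT; lra.
  - by rewrite lexx/=; apply: sub_all ls => p /le_trans; apply; exact: ltW.
  - rewrite ldisj andbT; apply: sub_all ls => p ps /=.
    by rewrite ps orbT.
  - rewrite /len big_cons/= EFinD addrC.
    have -> : inU s' = (inU s `|` `[s, s'[)%classic.
      apply/seteqP; split=> y; rewrite /inU /= !in_itv/=.
        move=> [Uy /andP[ay ys']]; have [ys|sy] := ltP y s; [left|right] => //.
        by rewrite ay.
      case=> [[Uy /andP[ay ys]]|/andP[sy ys']].
        by split=> //; rewrite ay (lt_trans ys).
      split; last by rewrite (le_trans a_s).
      by apply: etaU; rewrite /ball/= distrC ltr_norml; apply/andP; split; lra.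
    rewrite measureU//; last first.
      apply/seteqP; split=> y //=; rewrite /inU /= !in_itv/=.
      by case=> [[_ /andP[_ /lt_le_trans ys]] /andP[/ys]]; rewrite ltxx.
    apply: leeD => //.
    have := lebesgue_measure_itv `[s, s'[.
    by rewrite /= lte_fin ss' EFinB => ->.
  - rewrite /var big_cons/=.
    have -> : z s' - z a = (z s - z a) + (z s' - z s).
      by rewrite [RHS]addrC subrKA.
    apply: (le_trans (ler_normD _ _)); rewrite addrCA addrC lerD2r.
    apply: (le_trans lz); rewrite lerD2r ler_wpM2l//; lra.
have [v dv vM] : exists2 v, is_derive t 1 z v & `|v| <= M.
  by apply: contrapT => nv; apply: tU; apply: NU => /= /(_ tab).
have [eta eta0 etaP] := is_derive_local_bound e0 dv vM.
exists eta => // s s' a_s s_t t_s' s'_b s_eta s'_eta.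
move=> [l [[lab ls] [ldisj lU lz]]].
have ss' := le_trans s_t t_s'.
exists l; split; split=> //.
- by apply: sub_all ls => p /le_trans; apply.
- apply: (le_trans lU); apply: le_measure; rewrite ?inE//.
  by apply: setIS; apply: subset_itvl; rewrite bnd_simp.
- have zs : `|z t - z s| <= (M + e) * (t - s).
    rewrite distrC (le_trans (etaP _ _))// distrC ger0_norm ?subr_ge0//; lra.
  have zs' : `|z s' - z t| <= (M + e) * (s' - t).
    rewrite (le_trans (etaP _ _))// ger0_norm ?subr_ge0//; lra.
  have -> : z s' - z a = (z s - z a) + (z t - z s) + (z s' - z t).
    by rewrite -[RHS]addrA [X in _ = _ + X]addrC subrKA [RHS]addrC subrKA.
  rewrite (le_trans (ler_normD _ _))//.
  have := ler_normD (z s - z a) (z t - z s).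
  lra.
Qed.

(** * Linear differential equations *)

Lemma mulmx_norm_bound {R : realType} (p q : nat) (A : 'M[R]_(p, q)) :
  exists2 K, 0 <= K & forall v : 'cV[R]_q, `|A *m v| <= K * `|v|.
Proof.
have K0 : 0 <= \sum_i \sum_j `|A i j| by do 2?apply: sumr_ge0 => ? _.
exists (\sum_i \sum_j `|A i j|) => // v.
rewrite [leLHS]/Num.Def.normr/= mx_normrE bigmax_le ?mulr_ge0// => -[i k] _ /=.
rewrite mxE (le_trans (ler_norm_sum _ _ _))// (bigD1 i)//= mulrDl.
rewrite ler_wpDr ?mulr_ge0//; first by do 2?apply: sumr_ge0 => ? _.
rewrite mulr_suml; apply: ler_sum => j _.
rewrite normrM ler_wpM2l// [leRHS]/Num.Def.normr/= mx_normrE.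
exact: (le_bigmax _ _ (j, k)).
Qed.

(** Going back from [c] by steps of length [d] with [K * d <= 1/2], where [K]
    bounds the operator norm of [A]: if [z b = 0] and [m] maximizes the norm of
    [z] on a segment [s, b] of length at most [d], the mean value inequality on
    [m, b] gives [`|z m| <= K * d * `|z m|], hence [z] vanishes on [s, b]. *)
Lemma linear_ode_zero {R : realType} (n : nat) (A : 'M[R]_n) (z : R -> 'cV[R]_n)
    (a c : R) :
  a <= c -> absolutely_continuous `[a, c] z ->
  {ae @lebesgue_measure R, forall t,
     a <= t <= c -> is_derive t 1 z (A *m z t)} ->
  z c = 0 -> z a = 0.
Proof.
move=> ac acz dz zc0; have [K K0 AK] := mulmx_norm_bound A.
pose d := (2 * (K + 1))^-1; have d0 : 0 < d by rewrite invr_gt0; lra.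
have Kd : K * d <= 2^-1.
  by rewrite /d invfM mulrCA ler_piMr// ler_pdivrMr; lra.
suff back (k : nat) s : a <= s <= c -> c - k%:R * d <= s -> z s = 0.
  apply: (back (Num.bound ((c - a) / d))); first by rewrite lexx.
  rewrite lerBlDr -lerBlDl -ler_pdivrMr// ltW// archi_boundP//.
  by rewrite divr_ge0 ?subr_ge0// ltW.
elim: k s => [|k IH] s /andP[a_s s_c].
  rewrite mul0r subr0 => c_s.
  by have -> : s = c by apply/le_anti/andP.
move=> ks.
pose b := Num.max a (c - k%:R * d).
have [b_s|s_b] := leP b s.
  by apply: IH; [rewrite a_s|move: b_s; rewrite ge_max => /andP[]].
have a_b : a <= b by rewrite le_max lexx.
have b_c : b <= c by rewrite ge_max ac gerBl mulr_ge0// ltW.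
have zb0 : z b = 0 by apply: IH; [rewrite a_b|rewrite le_max lexx orbT].
have bs_d : b - s <= d.
  rewrite lerBlDr ge_max; move: ks; rewrite -natr1 mulrDl mul1r; lra.
have sub : {subset `[s, b] <= `[a, c]}.
  move=> t; rewrite !in_itv/= => /andP[st tb].
  by rewrite (le_trans a_s)// (le_trans tb).
have acs : absolutely_continuous `[s, b] z by exact: abs_cont_subset acz.
have cnt : {within `[s, b], continuous (fun t => `|z t|)}%classic.
  apply/subspace_continuousP => t /= tsb; apply/cvgrPdist_lt => e e0.
  have [eta eta0 etaP] := abs_cont_uniform acs e0.
  rewrite near_withinE; apply/nbhs_ballP; exists eta => //= r tr rsb.
  by rewrite (le_lt_trans (ler_dist_dist _ _))// etaP.
have [m msb mP] := EVT_max (ltW s_b) cnt.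
have [s_m m_b] : s <= m /\ m <= b by move: msb; rewrite in_itv/= => /andP[].
have : `|z b - z m| <= K * `|z m| * (b - m).
  apply: abs_cont_mean_value => //; first by rewrite mulr_ge0.
    apply: abs_cont_subset acs => t; rewrite !in_itv/= => /andP[mt ->].
    by rewrite (le_trans s_m).
  move: dz; apply: (@filterS _ (almost_everywhere (@lebesgue_measure R))).
  move=> t dzt /andP[mt tb]; exists (A *m z t).
    by apply: dzt; rewrite (le_trans a_s) ?(le_trans s_m)//= (le_trans tb).
  rewrite (le_trans (AK _))// ler_wpM2l// mP// in_itv/= tb (le_trans s_m)//.
rewrite zb0 sub0r normrN => zm.
have zm0 : `|z m| <= 0.
  have : `|z m| <= `|z m| * 2^-1.
    rewrite (le_trans zm)// mulrAC mulrC ler_wpM2l//.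
    by rewrite (le_trans _ Kd)// ler_wpM2l//; lra.
  lra.
apply/eqP; rewrite -normr_le0 (le_trans _ zm0)// mP//.
by rewrite in_itv/= lexx ltW.
Qed.

(** * Online experiment design *)

Lemma cols_mulmx {R : realType} (p N : nat) (f : nat -> 'cV[R]_p)
    (c : 'cV[R]_N) :
  cols f N *m c = \sum_(k < N) c k 0 *: f k.
Proof.
apply/colP => i; rewrite mxE summxE; apply: eq_bigr => k _.
by rewrite !mxE mulrC.
Qed.

(** If the last coefficient of a vanishing combination were nonzero, the last
    state and the last input would be the same combination of the previous
    ones; the first makes the design choose a covector [xi, eta], which then
    takes the same value on the last column as on a combination of the previous
    ones, namely zero. *)
Lemma online_design_free {R : realType} (n m N : nat) (chi : nat -> 'cV[R]_n)
    (mu : nat -> 'cV[R]_m) : online_design N chi mu ->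
  forall c : 'cV[R]_N, cols chi N *m c = 0 -> cols mu N *m c = 0 -> c = 0.
Proof.
case=> mu0 design.
suff main M : (M <= N)%N -> forall c : 'cV[R]_M,
    cols chi M *m c = 0 -> cols mu M *m c = 0 -> c = 0 by exact: main.
elim: M => [|M IH] MN c chi_c mu_c; first by apply/colP; case.
pose c' : 'cV[R]_M := \col_k c (widen_ord (leqnSn M) k) 0.
have split_last p (f : nat -> 'cV[R]_p) :
    cols f M.+1 *m c = cols f M *m c' + c ord_max 0 *: f M.
  rewrite !cols_mulmx big_ord_recr/=; congr (_ + _).
  by apply: eq_bigr => k _; rewrite mxE.
have [cM|cM] := eqVneq (c ord_max 0) 0.
  have c'0 : c' = 0.
    apply: IH; first exact: ltnW.
    - by move: chi_c; rewrite split_last cM scale0r addr0.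
    - by move: mu_c; rewrite split_last cM scale0r addr0.
  apply/colP => k; rewrite mxE.
  case: (unliftP ord_max k) => [j ->|->//].
  have := congr1 (fun w : 'cV[R]_M => w j 0) c'0; rewrite !mxE => <-.
  by congr (c _ _); apply: val_inj; rewrite /= /bump leqNgt ltn_ord.
have solve p (f : nat -> 'cV[R]_p) : cols f M.+1 *m c = 0 ->
    f M = cols f M *m (- (c ord_max 0)^-1 *: c').
  rewrite split_last addrC => /eqP; rewrite addr_eq0 => /eqP fM.
  by rewrite -[LHS](scalerK cM) fM scalerN scaleNr mulmxN scalemxAr.
have chiM := solve _ _ chi_c; have muM := solve _ _ mu_c.
(* The design only constrains later steps; at the first one the combination is
   empty, against [mu 0 != 0]. *)
have [M0|M0] := posnP M.
  case/eqP: mu0; suff: mu M = 0 by rewrite M0.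
  by rewrite muM cols_mulmx big1// => -[k kM]; exfalso; move: kM; rewrite M0.
have [||xi [eta [_ ker /eqP[]]]] := design M.
- by rewrite M0.
- by eexists; exact: chiM.
by rewrite chiM muM !mulmxA -mulmxDl -mul_row_col ker mul0mx.
Qed.

Theorem theorem2 (R : realType) (n m : nat) (A : 'M[R]_n) (B : 'M[R]_(n, m))
    (T : R) (u : R -> 'cV[R]_m) (x : R -> 'cV[R]_n) (mu : nat -> 'cV[R]_m) :
  controllable A B ->
  0 < T ->
  non_pathological A T ->
  trajectory A B ((n + m)%:R * T) u x ->
  (forall (k : nat) (t : R), (k < n + m)%N -> 0 <= t < T ->
     u (t + k%:R * T) = mu k) ->
  online_design (n + m) (sample x T 0) mu ->
  forall t : R, 0 <= t < T ->
    \rank (col_mx (cols (sample x T t) (n + m)) (cols mu (n + m))) = (n + m)%N.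
Proof.
move=> _ T0 _ [_ acx dx] umu design t /andP[t0 tT].
set N := (n + m)%N in dx acx umu design *.
have in_traj (k : 'I_N) s : 0 <= s < T -> 0 <= s + k%:R * T < N%:R * T.
  move=> /andP[s0 sT]; rewrite addr_ge0 ?mulr_ge0 ?(ltW T0)//=.
  apply: (lt_le_trans (y := k.+1%:R * T)).
    by rewrite -natr1 mulrDl mul1r addrC ltrD2l.
  by rewrite ler_wpM2r ?ler_nat// ltW.
set D := col_mx _ _; rewrite -mxrank_tr; apply/eqP/inj_row_free => v vD.
have {vD} : D *m v^T = 0 by rewrite -[D]trmxK -trmx_mul vD trmx0.
rewrite mul_col_mx !cols_mulmx -col_mx0 => /eq_col_mx[chi0 mu0].
pose z := \sum_(k < N) v^T k 0 \*: (x \o shift (k%:R * T)).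
have zE s : z s = \sum_(k < N) v^T k 0 *: x (s + k%:R * T).
  by rewrite /z fct_sumE.
have z0 : z 0 = 0.
  apply: (@linear_ode_zero _ _ A _ 0 t) => //; last by rewrite zE.
    apply: abs_cont_sum => k; apply: abs_contZ.
    apply: abs_cont_shift acx => s; rewrite !in_itv/= => /andP[s0 st].
    by apply: in_traj; rewrite s0 (le_lt_trans st).
  have : {ae @lebesgue_measure R, forall s, forall k : 'I_N,
      0 <= s + k%:R * T < N%:R * T ->
      is_derive (s + k%:R * T) 1 x
        (A *m x (s + k%:R * T) + B *m u (s + k%:R * T))}.
    apply: filter_forall => k; exact: (ae_shift (k%:R * T) dx).
  apply: (@filterS _ (almost_everywhere (@lebesgue_measure R))).
  move=> s ds /andP[s0 st].
  have sT : 0 <= s < T by rewrite s0 (le_lt_trans st).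
  (* The inputs can be added since their combination vanishes. *)
  have -> : A *m z s =
      \sum_(k < N) v^T k 0 *: (A *m x (s + k%:R * T) + B *m mu k).
    under eq_bigr do rewrite scalerDr !scalemxAr.
    by rewrite big_split/= -!mulmx_sumr mu0 mulmx0 addr0 zE.
  apply: is_derive_sum => k; apply: is_deriveZ.
  have := ds k (in_traj k s sT); rewrite umu//.
  exact: is_derive_comp_shift.
apply/eqP; rewrite -trmx_eq0; apply/eqP.
apply: (online_design_free design); rewrite cols_mulmx// -[RHS]z0 zE.
by apply: eq_bigr.
Qed.
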